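(* Let $X$ be a non-negative random variable with CDF $F$ which is DHRA, i.e. $F^{-1}\circ\mathcal{E}$ is star-shaped, where $\mathcal{E}(x)=1-e^{-x}$: the map $x\mapsto F^{-1}(1-e^{-x})/x$ is increasing on $(0,\infty)$. Let $1\le i\le n$ and $1\le j\le m$ be integers and define, for $x\ge 0$, $$Z(x)=\binom{n}{i}\, i\sum_{k=0}^{i-1}\binom{i-1}{k}(-1)^{i-1-k}\frac{(e^{-x})^{n-k}(-kx+nx+1)}{(k-n)^2}-\binom{m}{j}\, j\sum_{k=0}^{j-1}\binom{j-1}{k}(-1)^{j-1-k}\frac{(e^{-x})^{m-k}(-kx+mx+1)}{(k-m)^2}.$$ Let $R$ be the set of solutions $x\in(0,1)$ of the equation $$x^{\,i-j}(1-x)^{(n-i)-(m-j)}=\frac{\mathcal{B}(i,n-i+1)}{\mathcal{B}(j,m-j+1)},$$ where $\mathcal{B}$ is the beta function. If $Z(-\log(1-r))\geq 0$ for every $r\in R$, then $X_{i:n}\geq_{ss}X_{j:m}$.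
   Context: $F^{-1}(p)=\inf\{x:F(x)\ge p\}$. $X_{k:N}$ is the $k$-th order statistic of an i.i.d. sample of size $N$ from $F$. A function $u:[0,\infty)\to[0,\infty)$ with $u(0)=0$ is star-shaped if $u(x)/x$ is increasing on $(0,\infty)$. For non-negative random variables $V,W$, $V\geq_{ss}W$ means $\mathbb{E}\,u(V)\geq\mathbb{E}\,u(W)$ for every star-shaped $u$ for which the expectations exist. ''Increasing'' means non-decreasing. *)

(* Defs.v *)
From HB Require Import structures.
From mathcomp Require Import all_boot all_order all_algebra.
From mathcomp Require Import all_classical all_reals all_analysis.
From mathcomp Require Import beta_distribution.
Set Implicit Arguments. Unset Strict Implicit. Unset Printing Implicit Defensive.
Import Order.TTheory GRing.Theory Num.Theory.
Local Open Scope classical_set_scope.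
Local Open Scope ring_scope.

Section defs.
Context {R : realType}.

Definition cdfX d (T0 : measurableType d) (P0 : probability T0 R) (X : T0 -> R)
  (x : R) : R := fine (P0 [set t | X t <= x]).

Definition quantile (F : R -> R) (p : R) : R := inf [set x | p <= F x].

Definition Ecal (x : R) : R := 1 - expR (- x).

Definition DHRA (F : R -> R) : Prop :=
  forall x y : R, 0 < x -> x <= y ->
    quantile F (Ecal x) / x <= quantile F (Ecal y) / y.

(* u : [0,oo) -> [0,oo), u 0 = 0, u(x)/x increasing on (0,oo).
   (values of u at negative arguments are irrelevant) *)
Definition star_shaped (u : R -> R) : Prop :=
  [/\ u 0 = 0, (forall x, 0 <= x -> 0 <= u x) &
      forall x y : R, 0 < x -> x <= y -> u x / x <= u y / y].

Definition iid_sample d0 (T0 : measurableType d0) (P0 : probability T0 R)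
  (X : T0 -> R) d (T : measurableType d) (P : probability T R) (N : nat)
  (Xs : 'I_N -> T -> R) : Prop :=
  [/\ (forall i, measurable_fun setT (Xs i)),
      (forall (B : 'I_N -> set R), (forall i, measurable (B i)) ->
         P (\bigcap_(i in [set: 'I_N]) (Xs i @^-1` B i)) =
         (\prod_(i < N) P (Xs i @^-1` B i))%E) &
      (forall i (B : set R), measurable B ->
         P (Xs i @^-1` B) = P0 (X @^-1` B))].

Definition order_stat d (T : measurableType d) (N : nat) (Xs : 'I_N -> T -> R)
  (k : nat) (t : T) : R :=
  nth 0 (sort (fun a b : R => a <= b) [seq Xs i t | i <- enum 'I_N]) k.-1.

Definition ss_ge d1 (T1 : measurableType d1) (P1 : probability T1 R) (V : T1 -> R)
  d2 (T2 : measurableType d2) (P2 : probability T2 R) (W : T2 -> R) : Prop :=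
  forall u : R -> R, star_shaped u ->
    P1.-integrable setT (EFin \o (u \o V)) ->
    P2.-integrable setT (EFin \o (u \o W)) ->
    (\int[P2]_t (u (W t))%:E <= \int[P1]_t (u (V t))%:E)%E.

Definition Zpart (n i : nat) (x : R) : R :=
  'C(n, i)%:R * i%:R *
  \sum_(k < i) ('C(i.-1, k)%:R * (-1) ^+ (i.-1 - k) *
     (expR (- x) ^+ (n - k) * (- k%:R * x + n%:R * x + 1)
      / (k%:R - n%:R) ^+ 2)).

Definition Zfun (n i m j : nat) (x : R) : R := Zpart n i x - Zpart m j x.

Definition Rset (n i m j : nat) : set R :=
  [set x | 0 < x < 1 /\
     x ^ (i%:Z - j%:Z) * (1 - x) ^ ((n%:Z - i%:Z) - (m%:Z - j%:Z)) =
     beta_fun i (n - i + 1) / beta_fun j (m - j + 1)].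

End defs.

(* Main.v *)
(** The [k]-th order statistic of [n] standard exponential variables has density
[g(x) = k 'C(n, k) (1 - e^-x)^(k-1) e^(-(n-k+1)x)], and [Zpart n k x] is the
partial mean, the integral of [t g(t)] over [t >= x].  Since [F^-1 o E] maps the
order statistics of an exponential sample to those of a sample from [F], the
expectation of [u(X_{k:n})] is the integral of [rho(t) t g(t)] over [t > 0],
where [rho(t) = u(F^-1(E(t))) / t] is non-negative and increasing because both
[u] and [F^-1 o E] are star-shaped.  The superlevel sets of [rho] are rays, so
by the layer-cake formula it suffices that [Z >= 0] on [[0, oo)].

The critical points [x > 0] of [Z] are the points where the two densities agree,
that is [1 - e^-x \in R], so [Z >= 0] there by hypothesis; also [Z -> 0] at
infinity.  A negative value of [Z] then forces [Z] to be negative and increasing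
on an initial interval.  This is excluded by comparing [Z] with the difference
[D] of the two survival functions: [D(0) = D(oo) = 0] and [Z' = x D'], so [D]
is positive where [Z] first vanishes, whereas [(D - Z/x)' = Z/x^2 >= 0] from
there on makes it non-positive. *)

Require Import Defs.
From HB Require Import structures.
From mathcomp Require Import all_boot all_order all_algebra.
From mathcomp Require Import all_classical all_reals all_analysis.
From mathcomp Require Import beta_distribution.
From mathcomp Require Import measurable_realfun.
From mathcomp Require Import ring lra zify.
Set Implicit Arguments. Unset Strict Implicit. Unset Printing Implicit Defensive.
Import Order.TTheory GRing.Theory Num.Theory.
Import numFieldNormedType.Exports.
Local Open Scope classical_set_scope.
Local Open Scope ring_scope.

(** * Exponential order statistics *)

(** The survival function at [p] of the [k]-th order statistic of [n] uniform variables: fewer than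
    [k] of them are at most [p]. *)
Definition binomial_tail (R : realType) (n k : nat) (p : R) : R :=
  \sum_(l < k) 'C(n, l)%:R * (p ^+ l * (1 - p) ^+ (n - l)).

(* Density, for [x >= 0], of the [k]-th order statistic of [n] standard
   exponential variables. *)
Definition exp_order_density (R : realType) (n k : nat) (x : R) : R :=
  ('C(n, k) * k)%:R * (Ecal x ^+ k.-1 * expR (- x) ^+ (n - k).+1).

Section exponential_order_statistics.
Context (R : realType).
Implicit Types (x p : R) (n k : nat).

Lemma binomial_tail0 n k : (0 < k)%N -> binomial_tail n k (0 : R) = 1.
Proof.
case: k => // k _; rewrite /binomial_tail big_ord_recl bin0 mul1r mul1r subr0 expr1n.
by rewrite big1 ?addr0 // => l _; rewrite /= expr0n mul0r mulr0.
Qed.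

Lemma binomial_tail1 n k : (k <= n)%N -> binomial_tail n k (1 : R) = 0.
Proof.
move=> kn; rewrite /binomial_tail big1 // => l _; rewrite subrr expr0n subn_eq0.
by rewrite leqNgt (leq_trans (ltn_ord l) kn) !mulr0.
Qed.

Lemma is_derive_powfun (f : R -> R) x df n : is_derive x (1 : R) f df ->
  is_derive x (1 : R) (fun y => f y ^+ n) (n%:R * f x ^+ n.-1 * df).
Proof.
have -> : (fun y => f y ^+ n) = f ^+ n by apply/funext => y; rewrite !fctE.
by move=> fx; exact: is_deriveX.
Qed.

Lemma is_derive_expRN x : is_derive x (1 : R) (fun y => expR (- y)) (- expR (- x)).
Proof.
have dN := is_deriveN (is_derive_id x (1 : R)).
have := is_derive1_comp (is_derive_expR (- x)) dN.
by move=> /is_derive_eq; apply; rewrite mulrN1.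
Qed.

(** The derivative telescopes: the term of index [k] contributes two products, one cancelling the
    derivative of the earlier terms, the other rewritten by (n - k) C(n, k) = (k + 1) C(n, k +
    1). *)
Lemma is_derive_binomial_tail n k p : (k <= n)%N ->
  is_derive p (1 : R) (@binomial_tail R n k)
    (- (('C(n, k) * k)%:R * (p ^+ k.-1 * (1 - p) ^+ (n - k)))).
Proof.
elim: k => [|k IH] kn.
  have -> : @binomial_tail R n 0 = cst 0.
    by apply/funext => q; rewrite /binomial_tail big_ord0.
  by rewrite muln0 mul0r oppr0; exact: is_derive_cst.
have -> : @binomial_tail R n k.+1 = @binomial_tail R n k +
    (fun q => 'C(n, k)%:R * (q ^+ k * (1 - q) ^+ (n - k))).
  by apply/funext => q; rewrite /binomial_tail big_ord_recr.
have d1 : is_derive p (1 : R) (fun q : R => 1 - q) (- 1).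
  by rewrite -[- 1]add0r; apply: is_deriveB.
have := is_deriveD (IH (ltnW kn)) (is_deriveZ 'C(n, k)%:R
  (is_deriveM (is_derive_powfun k (is_derive_id p (1 : R)))
    (is_derive_powfun (n - k) d1))).
move=> /is_derive_eq; apply.
rewrite /GRing.scale /= !mulr1 [('C(n, k.+1) * _)%N]mulnC mul_bin_left !natrM.
have [m mE] : exists m, n = (k + m.+1)%N by exists (n - k.+1)%N; lia.
have -> : (n - k = m.+1)%N by lia.
have -> : (n - k.+1 = m)%N by lia.
rewrite succnK.
case: k {IH kn mE} => [|k] /=; first by rewrite expr0; ring.
rewrite !exprS; ring.
Qed.

Lemma is_derive_Ecal x : is_derive x (1 : R) (@Ecal R) (expR (- x)).
Proof.
have := is_deriveB (is_derive_cst (1 : R) x (1 : R)) (is_derive_expRN x).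
by move=> /is_derive_eq; apply; rewrite sub0r opprK.
Qed.

Lemma is_derive_tail_Ecal n k x : (1 <= k <= n)%N ->
  is_derive x (1 : R) (binomial_tail n k \o @Ecal R) (- exp_order_density n k x).
Proof.
move=> /andP[_ kn].
have := is_derive1_comp (is_derive_binomial_tail (Ecal x) kn) (is_derive_Ecal x).
move=> /is_derive_eq; apply.
by rewrite /exp_order_density /Ecal subKr exprSr; ring.
Qed.

(** Binomial expansion of [Ecal x ^+ k.-1] with [l] as the exponent of [1], so that signs and powers
    match those in [Zpart]. *)
Lemma exp_order_densityE n k x : (1 <= k <= n)%N ->
  exp_order_density n k x = ('C(n, k) * k)%:R *
    \sum_(l < k) 'C(k.-1, l)%:R * (-1) ^+ (k.-1 - l) * expR (- x) ^+ (n - l).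
Proof.
case: k => // k /= kn; rewrite /exp_order_density /Ecal addrC exprDn mulr_suml.
congr (_ * _); apply: eq_bigr => l _.
rewrite expr1n mulr1 -[X in X * _ = _]mulr_natl (exprNn (expR _)) -!mulrA -exprD.
have lk : (l <= k)%N by rewrite -ltnS; exact: ltn_ord.
by congr (_ * (_ * _ ^+ _)); move: lk kn; rewrite /=; move: (l : nat); lia.
Qed.

(** With c = n - l, a summand of [Zpart] is a constant times e^(-cx) (cx + 1) / c^2, and the
    derivative of the latter is -x e^(-cx). *)
Lemma is_derive_Zpart n k x : (1 <= k <= n)%N ->
  is_derive x (1 : R) (@Zpart R n k) (- (x * exp_order_density n k x)).
Proof.
move=> kn.
pose G (l : 'I_k) (x : R) := 'C(k.-1, l)%:R * (-1) ^+ (k.-1 - l) *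
     (expR (- x) ^+ (n - l) * (- l%:R * x + n%:R * x + 1) / (l%:R - n%:R) ^+ 2).
have -> : @Zpart R n k = ('C(n, k)%:R * k%:R) *: (\sum_(l < k) G l).
  by apply/funext => y; rewrite scalrfctE fct_sumE.
have dG (l : 'I_k) : is_derive x (1 : R) (G l)
    ('C(k.-1, l)%:R * (-1) ^+ (k.-1 - l) * (- (x * expR (- x) ^+ (n - l)))).
  have ln : (l < n)%N by case/andP: kn => _; exact: leq_trans.
  have d1 : is_derive x (1 : R)
      (fun y : R => - l%:R * y + n%:R * y + 1) (- l%:R + n%:R).
    have := is_deriveD (is_deriveD (is_deriveZ (- l%:R) (is_derive_id x (1 : R)))
      (is_deriveZ n%:R (is_derive_id x (1 : R)))) (is_derive_cst (1 : R) x (1 : R)).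
    by move=> /is_derive_eq; apply; rewrite addr0 /GRing.scale /= !mulr1.
  have := is_deriveZ ('C(k.-1, l)%:R * (-1) ^+ (k.-1 - l)) (is_deriveM
     (is_deriveM (is_derive_powfun (n - l) (is_derive_expRN x)) d1)
     (is_derive_cst (((l%:R - n%:R) ^+ 2)^-1 : R) x (1 : R))).
  move=> /is_derive_eq; apply.
  rewrite /GRing.scale /=.
  have [m mE] : exists m, (n - l = m.+1)%N by exists (n - l).-1; lia.
  have nE : n%:R = (l%:R + m.+1%:R : R) by rewrite -natrD; congr _%:R; lia.
  rewrite nE mE [expR _ ^+ m.+1]exprS mulr0 add0r opprD addrA subrr sub0r succnK.
  have : m.+1%:R != 0 :> R by rewrite pnatr_eq0.
  by move: m.+1%:R l%:R => c a c0; field.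
have := is_deriveZ ('C(n, k)%:R * k%:R) (is_derive_sum dG).
move=> /is_derive_eq; apply.
rewrite exp_order_densityE // natrM /GRing.scale /= !mulr_sumr -sumrN.
by apply: eq_bigr => l _; ring.
Qed.

Lemma cvg_tail_Ecal n k : (k <= n)%N ->
  (binomial_tail n k \o @Ecal R) x @[x --> +oo] --> (0 : R).
Proof.
move=> kn.
have E1 : @Ecal R x @[x --> +oo] --> (1 : R).
  rewrite -[1 in X in _ --> X]subr0; apply: cvgB; [exact: cvg_cst|exact: cvgr_expR].
have cT : {for 1, continuous (@binomial_tail R n k)}.
  apply/differentiable_continuous/derivable1_diffP.
  by have [] := is_derive_binomial_tail 1 kn.
rewrite -[0 in X in _ --> X](binomial_tail1 kn).
exact: (cvg_comp _ _ E1 cT).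
Qed.

Lemma cvg_pmull_pinfty (c : R) : 0 < c -> c * x @[x --> +oo] --> +oo.
Proof.
move=> c0; apply/cvgryPge => A; near=> x.
rewrite -ler_pdivrMl //; near: x; apply: nbhs_pinfty_ge; exact: num_real.
Unshelve. all: by end_near. Qed.

(** Half of the exponent absorbs the affine factor: x + 1 <= 2 e^(x/2) follows from e^y >= 1 + y,
    and the other half tends to 0. *)
Lemma cvg_expRN_affine : expR (- x) * (x + 1) @[x --> +oo] --> (0 : R).
Proof.
have cvgE : 2 * expR (- (2^-1 * x)) @[x --> +oo] --> (0 : R).
  rewrite -[0 in X in _ --> X](mulr0 (2 : R)); apply: cvgM; first exact: cvg_cst.
  by apply: (cvg_comp _ _ (cvg_pmull_pinfty _) (@cvgr_expR R)); rewrite invr_gt0.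
apply: (squeeze_cvgr _ (cvg_cst 0) cvgE); near=> x.
have x0 : 0 <= x by near: x; apply: nbhs_pinfty_ge; exact: num_real.
rewrite mulr_ge0 ?expR_ge0 ?addr_ge0 //=.
have xE : - x = - (2^-1 * x) + - (2^-1 * x) by field.
rewrite [in leLHS]xE expRD -mulrA mulrC ler_wpM2r ?expR_ge0 //.
rewrite expRN mulrC ler_pdivrMr ?expR_gt0 //.
have := expR_ge1Dx (2^-1 * x); lra.
Unshelve. all: by end_near. Qed.

Lemma cvg_Zpart n k : (1 <= k <= n)%N -> @Zpart R n k x @[x --> +oo] --> (0 : R).
Proof.
move=> /andP[_ kn].
rewrite -[0 in X in _ --> X](mulr0 ('C(n, k)%:R * k%:R)).
apply: cvgM; first exact: cvg_cst.
rewrite [0 in X in _ --> X](_ : 0 = \sum_(l < k) (0 : R)); last by rewrite big1.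
pose G (l : 'I_k) (x : R) : R := 'C(k.-1, l)%:R * (-1) ^+ (k.-1 - l) *
     (expR (- x) ^+ (n - l) * (- l%:R * x + n%:R * x + 1) / (l%:R - n%:R) ^+ 2).
have addC : continuous (fun z : R * R => z.1 + z.2).
  by move=> z; exact: add_continuous.
apply: (cvg_big addC (Ff := G)) => l _.
rewrite -[0 in X in _ --> X](mulr0 ('C(k.-1, l)%:R * (-1) ^+ (k.-1 - l))).
apply: cvgM; first exact: cvg_cst.
rewrite -[0 in X in _ --> X](mul0r ((l%:R - n%:R) ^+ 2)^-1).
apply: cvgM; last exact: cvg_cst.
have ln : (l < n)%N by exact: leq_trans (ltn_ord l) kn.
have c0 : 0 < (n - l)%:R :> R by rewrite ltr0n subn_gt0.
(* Up to constants, the summand is e^(-y) (y + 1) at y = (n - l) x. *)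
have := cvg_comp _ _ (cvg_pmull_pinfty c0) cvg_expRN_affine.
apply: cvg_trans; apply: near_eq_cvg; near=> x.
rewrite /= -mulrN expRM_natl natrB 1?ltnW //; ring.
Unshelve. all: by end_near. Qed.

End exponential_order_statistics.

(** * Non-negativity from critical points *)

Lemma is_derive_within_continuous (R : realType) (f df : R -> R) (a b : R) :
  (forall x, a <= x <= b -> is_derive x 1 f (df x)) ->
  {within `[a, b], continuous f}.
Proof.
move=> fd; apply: derivable_within_continuous => x; rewrite in_itv /= => xab.
by have [] := fd x xab.
Qed.

Lemma ler_is_derive_ge0 (R : realType) (f df : R -> R) (a b : R) :
  a <= b -> (forall x, a <= x <= b -> is_derive x 1 f (df x)) ->
  (forall x, a < x < b -> 0 <= df x) -> f a <= f b.
Proof.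
rewrite le_eqVlt => /predU1P[->//|ab] fd df0.
have fd' x : x \in `]a, b[ -> is_derive x 1 f (df x).
  by rewrite in_itv /= => /andP[ax xb]; apply: fd; rewrite !ltW.
have [c cab fE] := MVT ab fd' (is_derive_within_continuous fd).
rewrite in_itv /= in cab.
by rewrite -subr_ge0 fE mulr_ge0 ?subr_ge0 ?(ltW ab) //; exact: df0.
Qed.

Section critical_points.
Context (R : realType) (D Z d : R -> R).
Hypothesis derD : forall x : R, 0 <= x -> is_derive x (1 : R) D (d x).
Hypothesis derZ : forall x : R, 0 <= x -> is_derive x (1 : R) Z (x * d x).
Hypothesis D0 : D 0 = 0.
Hypothesis cvgD : D x @[x --> +oo] --> 0.
Hypothesis cvgZ : Z x @[x --> +oo] --> 0.
Hypothesis Zcrit : forall x : R, 0 < x -> d x = 0 -> 0 <= Z x.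

(** Otherwise, with [M] so far out that [Z M > Z x], the function [Z] has an interior minimum on
    [y, M] with value at most [Z x < 0]; such a critical point contradicts [Zcrit]. *)
Lemma neg_increasing (x y : R) : 0 < y < x -> Z x < 0 -> Z y < Z x.
Proof.
move=> /andP[y0 yx] Zx; rewrite ltNge; apply/negP => Zyx.
have [M [xM ZM]] : exists M, x < M /\ Z x < Z M.
  have : \forall M \near +oo, x < M /\ Z x < Z M.
    near=> M; split; near: M; first by apply: nbhs_pinfty_gt; exact: num_real.
    exact: cvgr_gt cvgZ _ Zx.
  by move=> /(@filter_ex _ _ _ _)[M [xM ZM]]; exists M.
have yM : y < M by exact: lt_trans xM.
have derZyM z : y <= z <= M -> is_derive z 1 Z (z * d z).
  by move=> /andP[yz _]; apply: derZ; rewrite (le_trans (ltW y0)).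
have [c] := EVT_min (ltW yM) (is_derive_within_continuous derZyM).
rewrite in_itv /= => /andP[yc cM] cmin.
have {}cmin z : y <= z <= M -> Z c <= Z z by move=> ?; apply: cmin.
have Zcx : Z c <= Z x by apply: cmin; rewrite !ltW.
have noncrit p : y < p < M -> Z p <= Z x ->
    (forall z, y <= z <= M -> Z p <= Z z) -> False.
  move=> pyM Zp pmin; have p0 : 0 < p by case/andP: pyM => /(lt_trans y0).
  have [_ dZp] : is_derive p 1 Z 0.
    apply: (@derive1_at_min _ Z y M) => [|t tyM|//|t tyM].
    - exact: ltW.
    - by have [] := derZyM t; rewrite // !ltW //; case/andP: tyM.
    - by apply: pmin; rewrite !ltW //; case/andP: tyM.
  have [_] := derZ (ltW p0); rewrite dZp => /esym/eqP.
  rewrite mulf_eq0 gt_eqF //= => /eqP /(Zcrit p0).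
  by rewrite leNgt (le_lt_trans Zp).
(* A minimum at the left end forces [Z x = Z y], so that [x] is an interior minimum as well; the
   right end is excluded by [Z x < Z M]. *)
have [ycE|ycN] := eqVneq y c.
  apply: (noncrit x); rewrite ?yx // => z zyM.
  by rewrite (le_trans Zyx) // ycE cmin.
apply: (noncrit c) => //; rewrite lt_neqAle ycN yc /=.
rewrite lt_neqAle cM andbT; apply: contraTneq Zcx => ->.
by rewrite -ltNge.
Unshelve. all: by end_near. Qed.

(** Below [y] all values of [Z] are negative, so [Z] increases there and its derivative [x * d x] is
    non-negative. *)
Lemma neg_derive_ge0 (x y : R) : 0 < x < y -> Z y < 0 -> 0 <= d x.
Proof.
move=> /andP[x0 xy] Zy.
have ZN z : 0 < z -> z < y -> Z z < 0.
  move=> z0 zy; rewrite (lt_trans _ Zy) //; apply: neg_increasing => //.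
  exact/andP.
have [_ dZ] := derZ (ltW x0).
rewrite -(pmulr_rge0 _ x0) -dZ -derive1E.
apply: (@incr_derive1_ge0_itv _ Z false true 0 y); last by rewrite in_itv /= x0.
- move=> z; rewrite inE /= in_itv /= => /andP[z0 _].
  by have [] := derZ (ltW z0).
- move=> u v; rewrite !in_itv /= => /andP[u0 uy] /andP[v0 vy] uv.
  by apply: neg_increasing; rewrite ?u0 // ZN.
Qed.

(** [D] grows from 0 up to x / 2, so it is non-negative there. From there to [x], the function D(z)
    - Z(z) / x has derivative (1 - z / x) d(z) >= 0, and the strict growth of [Z] makes [D x]
    positive. *)
Lemma neg_tail_gt0 (x : R) : 0 < x -> Z x < 0 -> 0 < D x.
Proof.
move=> x0 Zx; pose y := x / 2; have y0 : 0 < y by rewrite divr_gt0.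
have yx : y < x by rewrite /y; lra.
have D_ge0 : 0 <= D y.
  rewrite -D0; apply: (@ler_is_derive_ge0 _ _ d) => [|z /andP[z0 _]|z /andP[z0 zy]].
  - exact: ltW.
  - exact: derD.
  - by apply: (@neg_derive_ge0 z x); rewrite ?z0 ?(lt_trans zy).
have Zyx : Z y < Z x by apply: neg_increasing; rewrite ?y0.
have : D y - x^-1 * Z y <= D x - x^-1 * Z x.
  pose f z := D z - x^-1 * Z z; pose df z := d z - x^-1 * (z * d z).
  apply: (@ler_is_derive_ge0 _ f df) => [|z /andP[yz _]|z /andP[yz zx]].
  - exact: ltW.
  - have z0 : 0 <= z by rewrite (le_trans _ yz) // ltW.
    have ? := derD z0; have ? := derZ z0.
    by rewrite /f /df; apply: is_deriveB; apply: is_deriveZ.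
  - have z0 := lt_trans y0 yz.
    have dz : 0 <= d z by apply: (@neg_derive_ge0 z x); rewrite ?z0.
    rewrite /df mulrA -{1}[d z]mul1r -mulrBl mulr_ge0 // subr_ge0.
    by rewrite mulrC ler_pdivrMr // mul1r ltW.
have : x^-1 * Z y < x^-1 * Z x by rewrite ltr_pM2l ?invr_gt0.
by lra.
Qed.

(* [D - Z / x] has derivative [Z / x ^ 2] and tends to [0]. *)
Lemma nonneg_tail_le0 (b : R) : 0 < b -> Z b = 0 ->
  (forall x, b <= x -> 0 <= Z x) -> D b <= 0.
Proof.
move=> b0 Zb Zge0; pose K x := D x - Z x / x.
have Kb : K b = D b by rewrite /K Zb mul0r subr0.
have cvgK : K x @[x --> +oo] --> (0 : R).
  rewrite -[0 in X in _ --> X](subr0 (0:R)); apply: cvgB => //.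
  rewrite -[0 in X in _ --> X](mulr0 (0:R)); apply: cvgM => //.
  apply/gtr0_cvgV0; last exact: cvg_id.
  apply: nbhs_pinfty_gt; exact: num_real.
rewrite -Kb; apply: (ler_cvg_to (f := fun=> K b) (g := K) (cvg_cst _) cvgK).
near=> y.
have yb : b <= y by near: y; apply: nbhs_pinfty_ge; exact: num_real.
pose dK z := Z z / z ^+ 2.
apply: (@ler_is_derive_ge0 _ _ dK) => // z /andP[bz _].
  have z0 := lt_le_trans b0 bz.
  have zN0 : (id : R -> R) z != 0 by rewrite gt_eqF.
  have := is_deriveB (derD (ltW z0))
    (is_deriveM (derZ (ltW z0)) (is_deriveV zN0 (is_derive_id z (1 : R)))).
  move=> /is_derive_eq; apply.
  by rewrite /dK /GRing.scale /=; field.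
by rewrite /dK divr_ge0 ?Zge0 ?sqr_ge0 // ltW.
Unshelve. all: by end_near. Qed.

(* [b] is the supremum of [Z < 0]: there [Z b = 0], while [D b] would be both
   positive and non-positive. *)
Lemma critical_points_nonneg (x : R) : 0 < x -> 0 <= Z x.
Proof.
move=> x0; rewrite leNgt; apply/negP => Zx.
pose S := [set y | 0 < y /\ Z y < 0].
have Sx : S x by [].
(* If [S] is unbounded, then [Z < 0] and hence [d >= 0] on the whole open half-line, so [D] rises to
   its limit 0 and cannot be positive at [x]. *)
have [[M MS]|unb] := pselect (has_ubound S); last first.
  have Zneg y : 0 < y -> Z y < 0.
    move=> y0; have [z [[z0 Zz] yz]] : exists z, S z /\ y < z.
      apply: contrapT => H; apply: unb; exists y => z Sz.
      by rewrite leNgt; apply/negP => yz; apply: H; exists z.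
    by rewrite (lt_trans _ Zz) //; apply: neg_increasing => //; apply/andP.
  have : D x <= 0.
    apply: (ler_cvg_to (f := fun=> D x) (g := D) (cvg_cst _) cvgD).
    near=> y.
    have xy : x <= y by near: y; apply: nbhs_pinfty_ge; exact: num_real.
    apply: (@ler_is_derive_ge0 _ _ d) => // z /andP[xz _].
      by apply: derD; rewrite (le_trans (ltW x0)).
    have z0 := lt_trans x0 xz; apply: (@neg_derive_ge0 z (z + 1)).
      by apply/andP; rewrite ltrDl.
    by apply: Zneg; rewrite addr_gt0.
  by rewrite leNgt neg_tail_gt0.
have hS : has_sup S by split; [exists x|exists M].
pose b := sup S.
have xb : x <= b by apply: ub_le_sup Sx; exists M.
have b0 : 0 < b by exact: lt_le_trans xb.
have Zb_ge y : b < y -> 0 <= Z y.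
  move=> yb; rewrite leNgt; apply/negP => Zy.
  have : S y by split=> //; exact: lt_trans yb.
  by move=> /(ub_le_sup (ex_intro _ M MS)); rewrite leNgt yb.
have contZ : {for b, continuous Z}.
  by apply/differentiable_continuous/derivable1_diffP; have [] := derZ (ltW b0).
(* By continuity, a positive value at [b] would keep [S] away from its supremum, and a negative one
   would extend [S] beyond [b]. *)
have Zb : Z b = 0.
  apply/eqP; rewrite eq_le; apply/andP; split.
    rewrite leNgt; apply/negP => Zb0.
    have [e e0 He] : exists2 e : R, 0 < e & forall y, `|b - y| < e -> 0 < Z y.
      have : \forall y \near b, 0 < Z y by exact: (cvgr_gt _ contZ _ Zb0).
      move=> /nbhs_ballP[e /= e0 He].
      by exists e.
    have [y Sy ye] := sup_adherent e0 hS.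
    have yb : y <= b by apply: ub_le_sup Sy; exists M.
    have : 0 < Z y.
      by apply: He; rewrite ger0_norm ?subr_ge0 //; move: ye; rewrite -/b; lra.
    by case: Sy => _ /lt_trans /[apply]; rewrite ltxx.
  rewrite leNgt; apply/negP => Zb0.
  have [e e0 He] : exists2 e : R, 0 < e & forall y, `|b - y| < e -> Z y < 0.
    have : \forall y \near b, Z y < 0 by exact: (cvgr_lt _ contZ _ Zb0).
      move=> /nbhs_ballP[e /= e0 He].
    by exists e.
  have := He (b + e / 2); rewrite opprD addNKr normrN gtr0_norm ?divr_gt0 //.
  rewrite ltr_pdivrMr // ltr_pMr // ltr1n => /(_ isT).
  by rewrite ltNge Zb_ge // ltrDl divr_gt0.
have : D b <= 0.
  apply: nonneg_tail_le0 => // y; rewrite le_eqVlt => /predU1P[<-|/Zb_ge //].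
  by rewrite Zb.
rewrite leNgt => /negP; apply.
have xNb : x < b.
  by rewrite lt_neqAle xb andbT; apply: contraTneq Zx => ->; rewrite Zb ltxx.
(* Every [z] between [x] and [b] lies below a point of [S]; hence [d z >= 0], and [D] does not
   decrease from its positive value at [x]. *)
apply: (lt_le_trans (neg_tail_gt0 x0 Zx)).
apply: (@ler_is_derive_ge0 _ _ d) => // z /andP[xz zb].
  by apply: derD; rewrite (le_trans (ltW x0)).
have z0 := lt_trans x0 xz.
have [y [y0 Zy] zy] := sup_gt (ex_intro _ x Sx) zb.
by apply: (@neg_derive_ge0 z y); rewrite ?z0.
Unshelve. all: by end_near. Qed.

End critical_points.

(** * Layer-cake formula *)

Section layer_cake.
Context (R : realType) d (T : measurableType d)
  (nu : {sigma_finite_measure set T -> \bar R}) (D : set T) (f w : T -> R).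
Hypotheses (mD : measurable D) (mf : measurable_fun D f) (mw : measurable_fun D w).
Hypotheses (f0 : forall x, D x -> 0 <= f x) (w0 : forall x, D x -> 0 <= w x).
Local Notation mu := (@lebesgue_measure R).

(** The weight [w] on the region 0 <= s < f(x). Extension by zero outside [D] lets both integrals
    run over whole spaces, as Tonelli's theorem requires. *)
Let K (p : T * measurableTypeR R) : R :=
  \1_`[0, (f \_ D) p.1[%classic p.2 * (w \_ D) p.1.

Let wD_ge0 x : 0 <= (w \_ D) x.
Proof. by rewrite patchE; case: ifPn => // /set_mem/w0. Qed.

Let mK : measurable_fun [set: T * measurableTypeR R] (EFin \o K).
Proof.
have mfD : measurable_fun setT (f \_ D) by apply/(measurable_restrictT _ mD).
have mwD : measurable_fun setT (w \_ D) by apply/(measurable_restrictT _ mD).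
apply/measurable_EFinP; apply: measurable_funM; last first.
  exact: (measurableT_comp mwD).
pose A := [set p : T * measurableTypeR R | 0 <= p.2 /\ p.2 < (f \_ D) p.1].
rewrite (_ : (fun p => _) = \1_A); last first.
  apply/funext => p; rewrite !indicE; congr (_%:R); congr nat_of_bool.
  by apply/idP/idP; rewrite !inE /A /= in_itv /=; [move=> /andP[]|move=> [-> ->]].
apply: measurable_indic.
rewrite (_ : A = (fun p => 0 <= p.2) @^-1` [set true] `&`
    (fun p => p.2 < (f \_ D) p.1) @^-1` [set true]); last first.
  by apply/seteqP; split => p.
apply: measurableI; rewrite -[X in measurable X]setTI.
- have : measurable_fun setT (fun p : T * measurableTypeR R => 0 <= p.2).
    exact: measurable_fun_ler.
  by apply.
- have : measurable_fun setT (fun p : T * measurableTypeR R => p.2 < (f \_ D) p.1).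
    by apply: measurable_fun_ltr => //; exact: (measurableT_comp mfD).
  by apply.
Qed.

Let K_ge0 p : (0 <= (K p)%:E)%E.
Proof. by rewrite lee_fin mulr_ge0. Qed.

Let int_K_superlevel (s : R) : 0 <= s ->
  (\int[nu]_x (K (x, s))%:E =
   \int[nu]_(x in D `&` [set x | s < f x]%R) (w x)%:E)%E.
Proof.
move=> s0; rewrite [RHS]integral_mkcond; apply: eq_integral => x _.
rewrite /K /= indicE mem_setE in_itv /= s0 /= !patchE.
have [xD|xD] := boolP (x \in D); last first.
  by rewrite mulr0 memNset // => -[/mem_set]; rewrite (negbTE xD).
case: (boolP (s < f x)) => sf; rewrite ?mul1r ?mul0r.
  by rewrite mem_set //; split=> //; exact: set_mem.
by rewrite memNset // => -[_]; exact/negP.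
Qed.

(** Tonelli for [K]: integrating in [s] first yields [f x * w x], integrating in [x] first yields
    the superlevel integrals. *)
Lemma layer_cake :
  (\int[nu]_(x in D) (f x * w x)%:E =
   \int[mu]_(s in `[0%R, +oo[) \int[nu]_(x in D `&` [set x | s < f x]%R) (w x)%:E)%E.
Proof.
transitivity (\int[nu]_x \int[mu]_s (K (x, s))%:E)%E.
  rewrite integral_mkcond; apply: eq_integral => x _.
  rewrite /K /=.
  under eq_integral do rewrite EFinM.
  rewrite ge0_integralZr //=; last 2 first.
  - by apply: measurableT_comp => //; exact: measurable_indic.
  - by rewrite lee_fin.
  rewrite integral_indic //= setIT lebesgue_measure_itv /= lte_fin.
  rewrite !patchE; case: ifPn => xD; last by rewrite ltxx mule0.
  have := f0 (set_mem xD); rewrite le_eqVlt => /predU1P[<-|->].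
    by rewrite ltxx mul0r mul0e.
  by rewrite oppr0 adde0 EFinM.
rewrite (fubini_tonelli (EFin \o K)) //= [RHS]integral_mkcond.
apply: eq_integral => s _; rewrite patchE; case: ifPn => [|s0].
  by rewrite inE /= in_itv /= andbT => /int_K_superlevel.
apply: integral0_eq => x _; rewrite /K /= indicE memNset ?mul0r //=.
rewrite in_itv /= => /andP[s0' _]; move/negP: s0; apply.
by rewrite inE /= in_itv /= s0'.
Qed.

Lemma measurable_int_superlevel :
  measurable_fun (`[0, +oo[%classic : set R)
    (fun s : R => \int[nu]_(x in D `&` [set x | s < f x]%R) (w x)%:E)%E.
Proof.
apply: (@eq_measurable_fun _ _ _ _ _ (fun s => \int[nu]_x (K (x, s))%:E)%E).
  by move=> s; rewrite inE /= in_itv /= andbT => /int_K_superlevel.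
apply: measurable_funTS.
exact: (@measurable_fun_fubini_tonelli_G _ _ _ _ _ _ (EFin \o K)).
Qed.

End layer_cake.

Lemma le_integral_superlevel (R : realType) d (T : measurableType d)
    (nu : {sigma_finite_measure set T -> \bar R}) (D : set T) (f w1 w2 : T -> R) :
  measurable D -> measurable_fun D f ->
  measurable_fun D w1 -> measurable_fun D w2 ->
  (forall x, D x -> 0 <= f x) ->
  (forall x, D x -> 0 <= w1 x) -> (forall x, D x -> 0 <= w2 x) ->
  (forall s : R, (0 <= s)%R ->
    \int[nu]_(x in D `&` [set x | s < f x]%R) (w1 x)%:E <=
    \int[nu]_(x in D `&` [set x | s < f x]%R) (w2 x)%:E)%E ->
  (\int[nu]_(x in D) (f x * w1 x)%:E <= \int[nu]_(x in D) (f x * w2 x)%:E)%E.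
Proof.
move=> mD mf mw1 mw2 f0 w10 w20 w12.
rewrite !layer_cake //; apply: ge0_le_integral => //.
- by move=> s _; apply: integral_ge0 => x [Dx _]; rewrite lee_fin w10.
- exact: measurable_int_superlevel.
- exact: measurable_int_superlevel.
- by move=> s /=; rewrite in_itv /= andbT => /w12.
Qed.

(** The endpoint is [inf A]; the ray is closed exactly when [A] contains it. *)
Lemma up_closed_ray (R : realType) (A : set R) :
  A `<=` `]0, +oo[%classic ->
  (forall x y, A x -> x <= y -> A y) ->
  A = set0 \/ exists2 a, 0 <= a & A = `[a, +oo[%classic \/ A = `]a, +oo[%classic.
Proof.
move=> A0 up.
have [|/set0P[x0 Ax0]] := eqVneq A set0; first by left.
right; exists (inf A).
  by apply: lb_le_inf; [exists x0|move=> x /A0; rewrite /= in_itv /= andbT => /ltW].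
have lbA : has_lbound A.
  by exists 0 => x /A0; rewrite /= in_itv /= andbT => /ltW.
have gtA y : inf A < y -> A y.
  move=> /(inf_lt (ex_intro _ x0 Ax0)) [x Ax xy].
  by apply: up Ax _; exact: ltW.
have leA y : A y -> inf A <= y by move=> Ay; exact: ge_inf.
have [Aa|Aa] := pselect (A (inf A)); [left|right]; apply/seteqP; split=> y /=;
  rewrite in_itv /= andbT.
- exact: leA.
- by rewrite le_eqVlt => /predU1P[<-//|/gtA].
- move=> Ay; rewrite lt_neqAle leA // andbT; apply/eqP => ay.
  by apply: Aa; rewrite ay.
- exact: gtA.
Qed.

(** * Distribution of order statistics *)

(** In a sorted list the entries at most [x] form an initial segment. The rank [k] counts from one,
    whence [k.-1]. *)
Lemma sorted_nth_le (R : realType) (s : seq R) (k : nat) (x : R) :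
  sorted (fun a b : R => a <= b) s -> (0 < k <= size s)%N ->
  (nth 0 s k.-1 <= x) = (k <= count (fun y => (y <= x)%R) s)%N.
Proof.
elim: s k => [|a s IH] [|k] //= srt ks.
have gtx : (a <= x) = false -> all (fun y => (y <= x) == false) (a :: s).
  move=> ax; rewrite /= ax eqxx /=; apply/allP => y ys.
  have /allP/(_ y ys) ay := order_path_min le_trans srt.
  by apply/eqP/negbTE; rewrite -ltNge (lt_le_trans _ ay) // ltNge ax.
have count0 : (a <= x) = false -> count (fun y => y <= x) s = 0%N.
  move=> /gtx /= /andP[_ /allP h]; apply/eqP; rewrite -leqn0 leqNgt -has_count.
  by apply/hasPn => y /h /eqP ->.
case: k ks => [_|k ks] /=.
  by case: (boolP (a <= x)) => [//|/negbTE/count0 ->].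
rewrite (IH k.+1 (path_sorted srt) ks) /=.
by case: (boolP (a <= x)) => [//|/negbTE/count0 ->].
Qed.

Lemma order_stat_le d (T : measurableType d) (R : realType) (N k : nat)
    (Xs : 'I_N -> T -> R) (t : T) (x : R) : (0 < k <= N)%N ->
  (order_stat Xs k t <= x) = (k <= #|[set i | (Xs i t <= x)%R]%SET|)%N.
Proof.
move=> kN; rewrite /order_stat sorted_nth_le; last 2 first.
- by apply: sort_sorted; exact: le_total.
- by rewrite size_sort size_map size_enum_ord.
rewrite (permP (permEl (perm_sort _ _))) count_map enumT.
by rewrite cardsE cardE /enum_mem size_filter.
Qed.

Section order_statistic_law.
Context (R : realType) d (T : measurableType d) (P : probability T R) (N : nat)
  (Xs : 'I_N -> T -> R).
Hypothesis mXs : forall i, measurable_fun setT (Xs i).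

(** Chosen so that every [Xs i t] lies in its set exactly when [S] is the set of indices whose value
    is at most [x]. *)
Definition threshold_set (x : R) (S : {set 'I_N}) (i : 'I_N) : set R :=
  if i \in S then `]-oo, x]%classic else `]x, +oo[%classic.

(** The event splits according to the set [S] of indices with values at most [x], which leaves
    product events fit for independence. *)
Lemma order_stat_gtE (k : nat) (x : R) : (0 < k <= N)%N ->
  [set t | x < order_stat Xs k t] =
  \bigcup_(S in [set S : {set 'I_N} | (#|S| < k)%N])
    \bigcap_(i in [set: 'I_N]) (Xs i @^-1` threshold_set x S i).
Proof.
move=> kN; apply/seteqP; split => [t /=|t [S /= Sk tS]].
  rewrite ltNge order_stat_le // -ltnNge => ck.
  exists [set i | (Xs i t <= x)%R]%SET => // i _ /=.
  rewrite /threshold_set inE; case: ifPn; rewrite /= in_itv /= ?andbT //.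
  by rewrite -ltNge.
rewrite ltNge order_stat_le // -ltnNge.
suff -> : [set i | (Xs i t <= x)%R]%SET = S by [].
apply/setP => i; rewrite inE; have := tS i Logic.I.
rewrite /threshold_set /=; case: ifPn => iS; rewrite /= in_itv /= ?andbT // => Xx.
by apply/negbTE; rewrite -ltNge.
Qed.

Lemma measurable_threshold_set x S i : measurable (threshold_set x S i).
Proof. by rewrite /threshold_set; case: ifP. Qed.

Lemma measurable_threshold_event x S :
  measurable (\bigcap_(i in [set: 'I_N]) (Xs i @^-1` threshold_set x S i)).
Proof.
apply: fin_bigcap_measurable => // i _.
rewrite -[X in measurable X]setTI; apply: mXs => //.
exact: measurable_threshold_set.
Qed.

Lemma measurable_order_stat (k : nat) : (0 < k <= N)%N ->
  measurable_fun setT (order_stat Xs k).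
Proof.
move=> kN; apply: (measurability _ (RGenOInfty.measurableE R)) => //.
move=> _ [_ [x ->] <-]; rewrite setTI.
rewrite (_ : _ @^-1` _ = [set t | x < order_stat Xs k t]); last first.
  by apply/seteqP; split=> t /=; rewrite in_itv /= andbT.
rewrite order_stat_gtE //; apply: fin_bigcup_measurable => // S _.
exact: measurable_threshold_event.
Qed.

(** The events of distinct [S] are disjoint, each has probability p^|S| (1 - p)^(N - |S|) by
    independence, and C(N, l) sets have cardinality [l]. *)
Lemma prob_order_stat_gt (k : nat) (x p : R) : (0 < k <= N)%N ->
  (forall B : 'I_N -> set R, (forall i, measurable (B i)) ->
     P (\bigcap_(i in [set: 'I_N]) (Xs i @^-1` B i)) =
     (\prod_(i < N) P (Xs i @^-1` B i))%E) ->
  (forall i, P (Xs i @^-1` `]-oo, x]%classic) = p%:E) ->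
  P [set t | x < order_stat Xs k t] = (binomial_tail N k p)%:E.
Proof.
move=> kN indep Pp.
have Pq i : P (Xs i @^-1` `]x, +oo[%classic) = (1 - p)%:E.
  have mX : measurable (Xs i @^-1` `]-oo, x]%classic).
    by rewrite -[X in measurable X]setTI; apply: mXs.
  by rewrite -setCitvl preimage_setC probability_setC ?Pp.
rewrite order_stat_gtE // measure_fin_bigcup; last 3 first.
- exact: finite_finset.
- move=> S S' _ _ [t [tS tS']]; apply/setP => i.
  have := tS i Logic.I; have := tS' i Logic.I; rewrite /threshold_set /=.
  case: ifP => _; case: ifP => _ //=; rewrite !in_itv /= ?andbT.
  + by move=> h; rewrite ltNge h.
  + by rewrite ltNge => /negbTE ->.
- by move=> S _; exact: measurable_threshold_event.
have prodE (S : {set 'I_N}) :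
    P (\bigcap_(i in [set: 'I_N]) (Xs i @^-1` threshold_set x S i)) =
    (p ^+ #|S| * (1 - p) ^+ (N - #|S|))%:E.
  rewrite indep; last by move=> i; exact: measurable_threshold_set.
  rewrite (eq_bigr (fun i => (if i \in S then p else 1 - p)%:E)); last first.
    by move=> i _; rewrite /threshold_set; case: ifP.
  rewrite prodEFin (bigID (mem S)) /=; congr (_ * _)%:E.
    by rewrite (eq_bigr (fun=> p)) ?prodr_const // => i ->.
  rewrite (eq_bigr (fun=> 1 - p)); last by move=> i /negbTE ->.
  rewrite (eq_bigl (mem (~: S)%SET)); last by move=> i; rewrite !inE.
  by rewrite prodr_const cardsCs finset.setCK card_ord.
rewrite (eq_fsbigr (fun S : {set 'I_N} =>
  (p ^+ #|S| * (1 - p) ^+ (N - #|S|))%:E)); last by move=> S _; exact: prodE.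
rewrite -(@bigfs _ _ _ _ (index_enum {set 'I_N}) (fun S => (#|S| < k)%N));
  [|exact: index_enum_uniq|by move=> S _; rewrite mem_index_enum].
rewrite sumEFin; congr EFin.
(* A positive bound places the cardinalities in an inhabited ordinal type, by which the sum is
   regrouped. *)
case: k kN => // k kN.
rewrite (partition_big (fun S : {set 'I_N} => inord #|S| : 'I_k.+1) xpredT) //=.
apply: eq_bigr => l _.
rewrite (eq_bigl (fun S : {set 'I_N} => #|S| == l)); last first.
  move=> S; apply/andP/eqP => [[Sk /eqP <-]|Sl]; first by rewrite inordK.
  by rewrite Sl ltn_ord; split=> //; apply/eqP; exact: inord_val.
rewrite (eq_bigr (fun=> p ^+ l * (1 - p) ^+ (N - l))); last by move=> S /eqP ->.
by rewrite sumr_const -cardsE card_draws card_ord mulr_natl.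
Qed.

End order_statistic_law.

(** * Integrals against the exponential order statistics *)

Section exponential_integrals.
Context (R : realType).
Implicit Types (x y p a : R) (n k : nat).
Local Notation mu := (@lebesgue_measure R).

Lemma Ecal_ge0 x : 0 <= x -> 0 <= Ecal x.
Proof. by move=> x0; rewrite /Ecal subr_ge0 -expR0 ler_expR oppr_le0. Qed.

Lemma Ecal_gt0 x : 0 < x -> 0 < Ecal x.
Proof. by move=> x0; rewrite /Ecal subr_gt0 -expR0 ltr_expR oppr_lt0. Qed.

Lemma Ecal_lt1 x : Ecal x < 1.
Proof. by rewrite /Ecal ltrBlDr ltrDl expR_gt0. Qed.

Lemma ler_Ecal x y : x <= y -> Ecal x <= Ecal y.
Proof. by move=> xy; rewrite /Ecal lerD2l lerN2 ler_expR lerN2. Qed.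

Lemma EcalK x : - ln (1 - Ecal x) = x.
Proof. by rewrite /Ecal subKr expRK opprK. Qed.

Lemma Ecal_ln p : p < 1 -> Ecal (- ln (1 - p)) = p.
Proof. by move=> p1; rewrite /Ecal opprK lnK ?subKr // posrE subr_gt0. Qed.

Lemma exp_order_density_ge0 n k x : 0 <= x -> 0 <= exp_order_density n k x.
Proof.
by move=> x0; rewrite !mulr_ge0 ?exprn_ge0 ?Ecal_ge0 ?expR_ge0.
Qed.

Lemma continuous_exp_order_density n k : continuous (@exp_order_density R n k).
Proof.
move=> x.
have cE : {for x, continuous (@Ecal R)}.
  by apply/differentiable_continuous/derivable1_diffP; have [] := is_derive_Ecal x.
have cN : {for x, continuous (fun y : R => expR (- y))}.
  by apply/differentiable_continuous/derivable1_diffP; have [] := is_derive_expRN x.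
apply: cvgM; first exact: cvg_cst.
apply: cvgM.
  exact: (cvg_comp _ _ cE (@exprn_continuous _ k.-1 (Ecal x))).
exact: (cvg_comp _ _ cN (@exprn_continuous _ (n - k).+1 (expR (- x)))).
Qed.

(** The boolean [b] covers closed and open rays, since a superlevel set can be either. *)
Lemma integral_ray_antiderivative (f F : R -> R) a (b : bool) :
  continuous f -> (forall x, a <= x -> 0 <= f x) ->
  (forall x, is_derive x (1 : R) F (- f x)) ->
  F x @[x --> +oo] --> (0 : R) ->
  (\int[mu]_(x in [set` Interval (BSide b a) +oo%O]) (f x)%:E = (F a)%:E)%E.
Proof.
move=> cf f0 dF cvgF.
have -> : (\int[mu]_(x in [set` Interval (BSide b a) +oo%O]) (f x)%:E =
  \int[mu]_(x in `[a, +oo[) (f x)%:E)%E.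
  case: b => //; rewrite integral_itv_obnd_cbnd //.
  by apply/measurable_EFinP/measurable_funTS; exact: continuous_measurable_fun.
rewrite (@ge0_continuous_FTC2y _ f (- F) a 0) //.
- by rewrite sub0e -EFinN fctE opprK.
- exact: continuous_subspaceT.
- by rewrite -oppr0; exact: cvgN.
- apply: cvg_at_right_filter.
  apply/differentiable_continuous/derivable1_diffP.
  by have [] := is_deriveN (dF a).
- move=> x _; rewrite derive1E.
  by have [_ ->] := is_deriveN (dF x); rewrite opprK.
Qed.

Lemma integral_exp_order_density n k a b : (1 <= k <= n)%N -> 0 <= a ->
  (\int[mu]_(x in [set` Interval (BSide b a) +oo%O]) (exp_order_density n k x)%:E
    = (binomial_tail n k (Ecal a))%:E)%E.
Proof.
move=> kn a0.
apply: (@integral_ray_antiderivative _ (binomial_tail n k \o @Ecal R)).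
- exact: continuous_exp_order_density.
- by move=> x ax; rewrite exp_order_density_ge0 // (le_trans a0).
- by move=> x; exact: is_derive_tail_Ecal.
- by apply: cvg_tail_Ecal; case/andP: kn.
Qed.

Lemma integral_id_exp_order_density n k a b : (1 <= k <= n)%N -> 0 <= a ->
  (\int[mu]_(x in [set` Interval (BSide b a) +oo%O]) (x * exp_order_density n k x)%:E
    = (Zpart n k a)%:E)%E.
Proof.
move=> kn a0.
apply: (@integral_ray_antiderivative _ (Zpart n k)).
- move=> x; apply: cvgM; first exact: cvg_id.
  exact: continuous_exp_order_density.
- move=> x ax; have x0 := le_trans a0 ax.
  by rewrite mulr_ge0 ?exp_order_density_ge0.
- by move=> x; exact: is_derive_Zpart.
- exact: cvg_Zpart.
Qed.

(** Both sides are (k - 1)! (n - k)! / n!. *)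
Lemma beta_fun_bin n k : (1 <= k <= n)%N ->
  beta_fun k (n - k + 1) = (('C(n, k) * k)%:R)^-1 :> R.
Proof.
case: k => // k /= kn; rewrite addn1 beta_fun_fact.
have -> : (k + (n - k.+1)).+1 = n by lia.
rewrite -(bin_fact kn) factS; apply/eqP.
rewrite -[X in _ == X]mul1r eqr_div ?pnatr_eq0 -?lt0n ?muln_gt0 ?fact_gt0 ?bin_gt0 ?kn //.
by rewrite mul1r -natrM; apply/eqP; congr _%:R; ring.
Qed.

(** With r = [Ecal x] and 1 - r = e^(-x), the equation of [Rset] is the equality of densities
    divided through by powers of r and 1 - r; the two normalising constants are inverse beta
    values. *)
Lemma density_eq_Rset n i m j x : (1 <= i <= n)%N -> (1 <= j <= m)%N ->
  0 < x -> exp_order_density n i x = exp_order_density m j x ->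
  Rset n i m j (Ecal x).
Proof.
move=> iN jm x0 dE; rewrite /Rset /= Ecal_gt0 // Ecal_lt1; split => //.
rewrite !beta_fun_bin //.
have r0 : Ecal x != 0 by rewrite gt_eqF ?Ecal_gt0.
have E0 : expR (- x) != 0 by rewrite gt_eqF ?expR_gt0.
have -> : 1 - Ecal x = expR (- x) by rewrite /Ecal subKr.
have c0 (a b : nat) : (1 <= b <= a)%N -> ('C(a, b) * b)%:R != 0 :> R.
  by move=> /andP[b1 ba]; rewrite pnatr_eq0 -lt0n muln_gt0 bin_gt0 ba b1.
have ci := c0 _ _ iN; have cj := c0 _ _ jm.
case/andP: iN => i1 iN; case/andP: jm => j1 jm.
rewrite (subzn iN) (subzn jm) !expfzDr // -!invr_expz -!exprnP invrK.
move: dE; rewrite /exp_order_density.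
case: i i1 iN ci => // i _ _ ci; case: j j1 jm cj => // j _ _ cj.
rewrite !succnK !(exprS _ (n - _)) !(exprS _ (m - _)) !(exprS (Ecal x)).
move=> dE; have rj := expf_neq0 j r0; have qj := expf_neq0 (m - j.+1) E0.
move: (_ ^+ i) (_ ^+ (n - _)) (_ ^+ j) (_ ^+ (m - _)) rj qj dE => A Q1 B Q2 B0 Q20.
move: (Ecal x) (expR _) r0 E0 (_%:R) (_%:R) ci cj => r q r0 q0 c' c c_neq0 c'_neq0 dE.
(* Once [dE] is solved for [c'], an identity of rational functions remains. *)
have -> : c' = c * (A * (q * Q1)) / (B * (q * Q2)).
  by rewrite dE; field; rewrite B0 Q20 q0.
by field; rewrite ?c_neq0 ?B0 ?Q20 ?q0 ?r0.
Qed.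

Lemma Zfun_ge0 n i m j : (1 <= i <= n)%N -> (1 <= j <= m)%N ->
  (forall r, Rset (R:=R) n i m j r -> 0 <= Zfun n i m j (- ln (1 - r))) ->
  forall x, 0 <= x -> 0 <= Zfun n i m j x.
Proof.
move=> iN jm Zcrit.
have Zpos x : 0 < x -> 0 <= Zfun n i m j x.
  apply: (@critical_points_nonneg _
    ((binomial_tail n i \o @Ecal R) - (binomial_tail m j \o @Ecal R)) _
    (fun x => exp_order_density m j x - exp_order_density n i x)) => //.
  - move=> y _; have := is_deriveB (is_derive_tail_Ecal y iN) (is_derive_tail_Ecal y jm).
    by move=> /is_derive_eq; apply; rewrite opprK addrC.
  - move=> y _; have := is_deriveB (is_derive_Zpart y iN) (is_derive_Zpart y jm).
    by move=> /is_derive_eq; apply; ring.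
  - rewrite !fctE /= /Ecal oppr0 expR0 subrr !binomial_tail0 ?subrr //.
      by case/andP: jm.
    by case/andP: iN.
  - rewrite -[0 in X in _ --> X](subr0 (0 : R)); apply: cvgB.
      by apply: cvg_tail_Ecal; case/andP: iN.
    by apply: cvg_tail_Ecal; case/andP: jm.
  - rewrite -[0 in X in _ --> X](subr0 (0 : R)).
    by apply: cvgB; exact: cvg_Zpart.
  - move=> y y0 /eqP; rewrite subr_eq0 => /eqP dE.
    by have := Zcrit _ (density_eq_Rset iN jm y0 (esym dE)); rewrite EcalK.
(* The critical-point argument covers positive points only; the origin follows by continuity from
   the right. *)
move=> x; rewrite le_eqVlt => /predU1P[<-|/Zpos //].
have cZ : {for 0, continuous (@Zfun R n i m j)}.
  apply/differentiable_continuous/derivable1_diffP.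
  by have [] := is_deriveB (is_derive_Zpart (0 : R) iN) (is_derive_Zpart (0 : R) jm).
apply: (ler_cvg_to (f := fun=> 0) (cvg_cst _) (cvg_at_right_filter cZ)).
by near=> y; apply: Zpos; near: y; exact: nbhs_right_gt.
Unshelve. all: by end_near. Qed.

End exponential_integrals.

(** * Transport by the quantile function *)

Section quantile_function.
Context (R : realType) d0 (T0 : measurableType d0) (P0 : probability T0 R)
  (X : T0 -> R).
Hypotheses (mX : measurable_fun setT X) (X0 : forall t, 0 <= X t).
Local Notation F := (cdfX P0 X).

Let Xrv : {RV P0 >-> R} := HB.pack X (isMeasurableFun.Build _ _ _ _ X mX).

Lemma cdfXE x : (F x)%:E = P0 (X @^-1` `]-oo, x]%classic).
Proof.
have XE : [set t | X t <= x] = X @^-1` `]-oo, x]%classic.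
  by apply/seteqP; split=> t; rewrite /= in_itv.
rewrite /cdfX XE fineK // fin_num_measure // -[X in measurable X]setTI.
exact: mX.
Qed.

Let cdfX_cdf x : (F x)%:E = cdf Xrv x.
Proof. exact: cdfXE. Qed.

Let cdfX_fine : F = fine \o cdf Xrv.
Proof. by apply/funext => x /=; rewrite -cdfX_cdf. Qed.

Lemma cdfX_ge0 x : 0 <= F x.
Proof. by rewrite -lee_fin cdfX_cdf cdf_ge0. Qed.

Lemma cdfX_le1 x : F x <= 1.
Proof. by rewrite -lee_fin cdfX_cdf cdf_le1. Qed.

Lemma ler_cdfX x y : x <= y -> F x <= F y.
Proof. by move=> xy; rewrite -lee_fin !cdfX_cdf cdf_nondecreasing. Qed.

Lemma cdfX_lt0 x : x < 0 -> F x = 0.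
Proof.
move=> x0; apply: EFin_inj; rewrite cdfXE (_ : _ @^-1` _ = set0) ?measure0 //.
apply/seteqP; split=> t //=; rewrite in_itv /= => Xx.
by have := le_lt_trans Xx x0; rewrite ltNge X0.
Qed.

Lemma cdfX_near1 p : p < 1 -> exists x, p <= F x.
Proof.
move=> p1; have cF : F x @[x --> +oo] --> (1 : R).
  by rewrite cdfX_fine; exact: (fine_cvg (cvg_cdfy1 Xrv)).
by have [x /ltW px] := @filter_ex _ _ _ _ (cvgr_gt _ cF _ p1); exists x.
Qed.

Lemma cdfX_right p x : F x < p -> exists2 y, x < y & F y < p.
Proof.
move=> Fp; have cF : F y @[y --> x^'+] --> F x.
  suff : (fine \o cdf Xrv) y @[y --> x^'+] --> F x by rewrite -cdfX_fine.
  apply: fine_cvg; rewrite cdfX_cdf.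
  exact: (@cdf_right_continuous _ _ _ _ Xrv x).
have [y [xy Fy]] : exists y, x < y /\ F y < p.
  apply: (@filter_ex _ x^'+); near=> y; split; near: y.
    exact: nbhs_right_gt.
  exact: (cvgr_lt _ cF).
by exists y.
Unshelve. all: by end_near. Qed.

(** For 0 < p < 1 the set under [inf] is non-empty and bounded below by 0, so the infimum is
    genuine. Right continuity of [F] keeps it above [x] when [F x < p]. *)
Lemma quantile_le p x : 0 < p < 1 -> (quantile F p <= x) = (p <= F x).
Proof.
move=> /andP[p0 p1].
have lbS : lbound [set y | p <= F y] 0.
  move=> y /= pF; rewrite leNgt; apply/negP => /cdfX_lt0 Fy.
  by move: pF; rewrite Fy leNgt p0.
apply/idP/idP => [|pF]; last by apply: ge_inf => //; exists 0.
apply: contraTT; rewrite -!ltNge => /cdfX_right[y xy Fyp].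
apply: (lt_le_trans xy); apply: lb_le_inf; first exact: cdfX_near1.
move=> z /= pFz; rewrite leNgt; apply/negP => /ltW/ler_cdfX.
by rewrite leNgt (lt_le_trans Fyp).
Qed.

Lemma quantile_ge0 p : 0 < p < 1 -> 0 <= quantile F p.
Proof.
move=> p01; rewrite leNgt; apply/negP => q0.
have := quantile_le (quantile F p) p01; rewrite lexx cdfX_lt0 //.
by case/andP: p01 => p0 _ /esym; rewrite leNgt p0.
Qed.

Lemma ler_quantile p q : 0 < p -> p <= q -> q < 1 -> quantile F p <= quantile F q.
Proof.
move=> p0 pq q1; rewrite quantile_le ?p0 ?(le_lt_trans pq) //.
by rewrite (le_trans pq) // -quantile_le ?q1 ?(lt_le_trans p0).
Qed.

(* [F^-1 o E], extended by [0] to the left of the origin. *)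
Definition exp_transport (x : R) : R := if 0 < x then quantile F (Ecal x) else 0.

Let Ecal01 (x : R) : 0 < x -> 0 < Ecal x < 1.
Proof. by move=> x0; rewrite Ecal_gt0 // Ecal_lt1. Qed.

Lemma exp_transport_ge0 x : 0 <= exp_transport x.
Proof. by rewrite /exp_transport; case: ifPn => // /Ecal01/quantile_ge0. Qed.

Lemma ler_exp_transport x y : x <= y -> exp_transport x <= exp_transport y.
Proof.
move=> xy; rewrite {1}/exp_transport; case: ifPn => [x0|_]; last exact: exp_transport_ge0.
rewrite /exp_transport (lt_le_trans x0) // ler_quantile ?Ecal_gt0 ?Ecal_lt1 //.
exact: ler_Ecal.
Qed.

Lemma measurable_exp_transport : measurable_fun setT exp_transport.
Proof. by apply: nondecreasing_measurable => // x y; exact: ler_exp_transport. Qed.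

Lemma exp_transport_gt x t : 0 < t -> (x < exp_transport t) = (F x < Ecal t).
Proof. by move=> t0; rewrite ltNge /exp_transport t0 quantile_le ?Ecal01 // -ltNge. Qed.

End quantile_function.

(** * The law of an order statistic as an image of its exponential counterpart *)

Section order_statistic_transport.
Context (R : realType) d0 (T0 : measurableType d0) (P0 : probability T0 R)
  (X : T0 -> R).
Hypotheses (mX : measurable_fun setT X) (X0 : forall t, 0 <= X t).
Context d (T : measurableType d) (P : probability T R) (N k : nat)
  (Xs : 'I_N -> T -> R).
Hypotheses (iidX : iid_sample P0 X P Xs) (kN : (1 <= k <= N)%N).
Local Notation F := (cdfX P0 X).
Local Notation mu := (@lebesgue_measure R).
Local Notation phi := (exp_transport P0 X).
Local Notation D := (`]0, +oo[%classic : set R).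
Local Notation g := (exp_order_density N k).

Let mXs i : measurable_fun setT (Xs i). Proof. by case: iidX. Qed.

Let mV : measurable_fun setT (order_stat Xs k).
Proof. exact: measurable_order_stat. Qed.

Let mphi (A : set R) : measurable A -> measurable (phi @^-1` A).
Proof.
move=> mA; rewrite -[X in measurable X]setTI.
exact: (measurable_exp_transport P0 mX X0).
Qed.

Let mg (A : set R) : measurable_fun A (EFin \o g).
Proof.
apply/measurable_funTS/measurable_EFinP; apply: continuous_measurable_fun.
exact: continuous_exp_order_density.
Qed.

Let g0 (A : set R) x : (D `&` A) x -> (0 <= (g x)%:E)%E.
Proof.
by rewrite /= in_itv /= andbT => -[/ltW x0 _]; rewrite lee_fin exp_order_density_ge0.
Qed.

(** The image under [phi] of the law with density [g] on [D]. *)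
Let law (A : set R) : \bar R := (\int[mu]_(t in D `&` phi @^-1` A) (g t)%:E)%E.

Let law0 : law set0 = 0%E.
Proof. by rewrite /law preimage_set0 setI0 integral_set0. Qed.

Let law_ge0 A : (0 <= law A)%E.
Proof. by apply: integral_ge0 => x; exact: g0. Qed.

Let law_sigma_additive : semi_sigma_additive law.
Proof.
move=> A mA tA mUA; rewrite /law; apply: cvg_toP.
  apply: ereal_nondecreasing_is_cvgn => m n mn.
  by apply: lee_sum_nneg_natr => // l _ _; exact: law_ge0.
rewrite preimage_bigcup setI_bigcupr ge0_integral_bigcup //=.
- by move=> l; apply: measurableI => //; exact: mphi.
- exact: mg.
- by move=> x [l _]; exact: g0.
- move=> l l' _ _ [x [[_ Al] [_ Al']]].
  by apply: tA => //; exists (phi x).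
Qed.

Let lawM : {measure set R -> \bar R} :=
  HB.pack law (isMeasure.Build _ _ _ law law0 law_ge0 law_sigma_additive).

(** If [F x < 1], then [phi t > x] means t > -ln(1 - F(x)), and both sides are the binomial tail at
    [F x]; if [F x = 1], both vanish. *)
Let law_ray x : P (order_stat Xs k @^-1` `]x, +oo[%classic) = law `]x, +oo[%classic.
Proof.
have -> : order_stat Xs k @^-1` `]x, +oo[%classic = [set t | x < order_stat Xs k t].
  by apply/seteqP; split=> t; rewrite /= in_itv /= andbT.
have [_ indep idd] : [/\ _, _ & _] := iidX.
rewrite (@prob_order_stat_gt _ _ _ _ _ _ mXs _ _ (F x)) //; last first.
  by move=> i; rewrite idd // cdfXE.
rewrite /law; have [F1|F1] := ltP (F x) 1.
  have a0 : 0 <= - ln (1 - F x).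
    by rewrite oppr_ge0 ln_le0 // lerBlDr lerDl cdfX_ge0.
  rewrite (_ : _ `&` _ = `]- ln (1 - F x), +oo[%classic).
    by rewrite integral_exp_order_density // Ecal_ln.
  apply/seteqP; split=> t; rewrite /= !in_itv /= !andbT.
    move=> [t0]; rewrite exp_transport_gt // -{1}(Ecal_ln F1).
    by rewrite ltNge => /(contra (@ler_Ecal _ _ _)); rewrite -ltNge.
  move=> at_; have t0 : 0 < t by exact: le_lt_trans at_.
  split=> //; rewrite exp_transport_gt // -(Ecal_ln F1).
  by rewrite /Ecal ltrD2l ltrN2 ltr_expR ltrN2.
have -> : F x = 1 by apply/eqP; rewrite eq_le cdfX_le1.
rewrite binomial_tail1; last by case/andP: kN.
rewrite (_ : _ `&` _ = set0) ?integral_set0 //.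
apply/seteqP; split=> t //=; rewrite !in_itv /= !andbT => -[t0].
by rewrite exp_transport_gt // ltNge (le_trans _ F1) // ltW // Ecal_lt1.
Qed.

(** The two measures agree on the open upper rays, a generating family stable under intersection, so
    they coincide. *)
Lemma order_stat_transport (A : set R) : measurable A ->
  P (order_stat Xs k @^-1` A) =
  (\int[mu]_(t in D `&` phi @^-1` A) (g t)%:E)%E.
Proof.
move=> mA.
pose V : {RV P >-> R} := HB.pack (order_stat Xs k) (isMeasurableFun.Build _ _ _ _ _ mV).
apply: (measure_unique (@RGenOInfty.G R) (fun n => `]- n%:R, +oo[%classic)
  _ _ _ _ (distribution P V) lawM) => //.
- exact: RGenOInfty.measurableE.
- move=> _ _ [x ->] [y ->]; exists (Num.max x y).
  by apply/seteqP; split=> t; rewrite /= !in_itv /= !andbT gt_max => /andP.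
- by move=> n; exists (- n%:R).
- apply/seteqP; split=> // t _; exists (Num.truncn `|t|).+1 => //=.
  rewrite in_itv /= andbT ltrNl.
  by rewrite (le_lt_trans (ler_norm _)) // normrN truncnS_gt.
- by move=> _ [x ->]; exact: law_ray.
- by move=> n; rewrite ltey_eq fin_num_measure.
Qed.

(** After the layer-cake formula on both sides, with weight 1 on the left, [order_stat_transport]
    identifies the integrands at each level [s]. *)
Lemma integral_order_stat (u : R -> R) :
  {homo u : x y / x <= y} -> (forall x, 0 <= u x) ->
  (\int[P]_t (u (order_stat Xs k t))%:E =
   \int[mu]_(x in D) (u (phi x) * g x)%:E)%E.
Proof.
move=> uhomo u0.
have mu_ : measurable_fun setT u by exact: nondecreasing_measurable.
transitivity (\int[P]_t (u (order_stat Xs k t) * 1)%:E)%E.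
  by apply: eq_integral => t _; rewrite mulr1.
rewrite layer_cake //; last 1 first.
  exact: (measurableT_comp mu_ mV).
rewrite [RHS]layer_cake //; last 3 first.
- apply: measurable_funTS; apply: (measurableT_comp mu_).
  exact: measurable_exp_transport.
- apply: measurable_funTS; apply: continuous_measurable_fun.
  exact: continuous_exp_order_density.
- by move=> x; rewrite /= in_itv /= andbT => /ltW/exp_order_density_ge0.
apply: eq_integral => s _.
have mU : measurable [set x | s < u x].
  rewrite (_ : [set x | s < u x] = u @^-1` `]s, +oo[%classic).
    by rewrite -[X in measurable X]setTI; exact: mu_.
  by apply/seteqP; split=> t; rewrite /= in_itv /= andbT.
rewrite -[RHS](order_stat_transport mU) setTI integral_cst ?mul1e //.
by have := mV measurableT mU; rewrite setTI.
Qed.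

End order_statistic_transport.

(** * Comparison in the star-shaped order *)

Theorem theorem16 (R : realType) (d0 : measure_display) (T0 : measurableType d0)
  (P0 : probability T0 R) (X : T0 -> R) (n i m j : nat) :
  measurable_fun setT X ->
  (forall t, 0 <= X t) ->
  DHRA (cdfX P0 X) ->
  (1 <= i <= n)%N -> (1 <= j <= m)%N ->
  (forall r, Rset (R:=R) n i m j r -> 0 <= Zfun n i m j (- ln (1 - r))) ->
  forall (d1 : measure_display) (T1 : measurableType d1) (P1 : probability T1 R)
    (Xs1 : 'I_n -> T1 -> R)
    (d2 : measure_display) (T2 : measurableType d2) (P2 : probability T2 R)
    (Xs2 : 'I_m -> T2 -> R),
  iid_sample P0 X P1 Xs1 -> iid_sample P0 X P2 Xs2 ->
  ss_ge P1 (order_stat Xs1 i) P2 (order_stat Xs2 j).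
Proof.
move=> mX X0 dhra iN jm Zcrit d1 T1 P1 Xs1 d2 T2 P2 Xs2 iid1 iid2.
move=> u [u0 uge0 ustar] int1 int2.
(* Negative arguments of [u] are unconstrained; the value 0 there makes [v] non-negative and
   increasing on the whole line, hence measurable. *)
pose v x := if 0 <= x then u x else 0.
have v_ge0 x : 0 <= v x by rewrite /v; case: ifPn => // /uge0.
have v_homo : {homo v : x y / x <= y}.
  move=> x y xy; rewrite {1}/v; case: ifPn => [|_]; last exact: v_ge0.
  rewrite le_eqVlt => /predU1P[<-|x0]; first by rewrite u0.
  have y0 := lt_le_trans x0 xy.
  rewrite /v (ltW y0); have := ustar _ _ x0 xy.
  rewrite ler_pdivrMr // => /le_trans; apply.
  by rewrite -mulrA ler_piMr ?uge0 ?(ltW y0) // mulrC ler_pdivrMr // mul1r.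
have vE d (T : measurableType d) (P : probability T R) (N k : nat)
    (Xs : 'I_N -> T -> R) : (1 <= k <= N)%N -> iid_sample P0 X P Xs ->
    P.-integrable setT (EFin \o (u \o order_stat Xs k)) ->
    (\int[P]_t (u (order_stat Xs k t))%:E =
     \int[@lebesgue_measure R]_(x in `]0%R, +oo[)
       (v (exp_transport P0 X x) / x * (x * exp_order_density N k x))%:E)%E.
  move=> kN iidX intu.
  have mV : measurable_fun setT (order_stat Xs k).
    by apply: measurable_order_stat => //; case: iidX.
  transitivity (\int[P]_t (v (order_stat Xs k t))%:E)%E.
    (* The sample is non-negative only almost surely, so [u] and [v] are exchanged outside the null
       event of a negative order statistic. *)
    apply: ae_eq_integral => //.
    - exact: measurable_int intu.
    - apply/measurable_EFinP; apply: (@measurableT_comp _ _ _ _ _ _ v) => //.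
      exact: nondecreasing_measurable.
    exists (order_stat Xs k @^-1` `]-oo, 0[%classic); split.
    - by rewrite -[X in measurable X]setTI; exact: mV.
    - apply: etrans (order_stat_transport mX X0 iidX kN (measurable_itv _)) _.
      rewrite (_ : _ `&` _ = set0) ?integral_set0 //.
      apply/seteqP; split=> t //= [_]; rewrite in_itv /=.
      by rewrite ltNge exp_transport_ge0.
    - move=> t /= /not_implyP[_ uv]; rewrite in_itv /= ltNge.
      by apply/negP => V0; apply: uv; rewrite /v V0.
  rewrite (integral_order_stat mX X0 iidX kN v_homo v_ge0).
  apply: eq_integral => x; rewrite inE /= in_itv /= andbT => x0.
  by congr EFin; field; rewrite gt_eqF.
rewrite (vE _ _ _ _ _ _ iN iid1 int1) (vE _ _ _ _ _ _ jm iid2 int2).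
pose rho x := v (exp_transport P0 X x) / x.
have rho_homo : {homo rho : x y / x <= y}.
  move=> x y xy; have [x0|x0] := leP x 0.
    have v0 : v 0 = 0 by rewrite /v lexx u0.
    rewrite /rho {1}/exp_transport ltNge x0 /= v0 mul0r.
    have [y0|y0] := leP y 0; last by rewrite divr_ge0 // ltW.
    by rewrite /exp_transport ltNge y0 /= v0 mul0r.
  have y0 := lt_le_trans x0 xy.
  have px := exp_transport_ge0 P0 mX X0 x.
  have py := exp_transport_ge0 P0 mX X0 y.
  rewrite /rho /v px py.
  (* For z = phi(x) > 0, [rho] is the product of u(z) / z and z / x, both non-negative and
     increasing; z = 0 is separate because star-shapedness concerns positive arguments. *)
  move: px; rewrite le_eqVlt => /predU1P[<-|px].
    by rewrite u0 mul0r divr_ge0 ?uge0 // ltW.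
  have pxy := @ler_exp_transport _ _ _ P0 _ mX X0 _ _ xy.
  have py' := lt_le_trans px pxy.
  have h1 := ustar _ _ px pxy.
  have h2 : exp_transport P0 X x / x <= exp_transport P0 X y / y.
    by rewrite /exp_transport x0 y0; exact: dhra.
  have xE (z w : R) : z != 0 -> u z / w = u z / z * (z / w).
    by move=> z0; rewrite mulrA divfK.
  rewrite (xE _ x) ?gt_eqF // (xE _ y) ?gt_eqF // ler_pM //.
  - by rewrite divr_ge0 ?uge0 // ltW.
  - by rewrite divr_ge0 // ltW.
have meas_id_g N k : measurable_fun (`]0, +oo[%classic : set R)
    (fun x : R => x * exp_order_density N k x).
  apply: measurable_funTS; apply: measurable_funM => //.
  by apply: continuous_measurable_fun; exact: continuous_exp_order_density.
apply: le_integral_superlevel => //.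
- exact: nondecreasing_measurable.
- exact: meas_id_g.
- exact: meas_id_g.
- by move=> x; rewrite /= in_itv /= andbT => x0; rewrite divr_ge0 // ltW.
- move=> x; rewrite /= in_itv /= andbT => /ltW x0.
  by rewrite mulr_ge0 // exp_order_density_ge0.
- move=> x; rewrite /= in_itv /= andbT => /ltW x0.
  by rewrite mulr_ge0 // exp_order_density_ge0.
move=> s s0.
(* On a ray from [a] the two integrals are values of [Zpart], and their difference is the value of
   [Zfun] at [a]. *)
have [||->|[a a0 AE]] := @up_closed_ray R (`]0, +oo[ `&` [set x | s < rho x]).
- by move=> x [].
- move=> x y; rewrite /= !in_itv /= !andbT => -[x0 sx] xy; split.
    exact: lt_le_trans xy.
  by apply: lt_le_trans sx _; exact: rho_homo.
- by rewrite !integral_set0.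
have [b ->] : exists b,
    `]0, +oo[ `&` [set x | s < rho x] = [set` Interval (BSide b a) +oo%O].
  by case: AE => ->; [exists true|exists false].
rewrite !integral_id_exp_order_density // lee_fin -subr_ge0.
exact: Zfun_ge0.
Qed.
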